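(* The operad $\mathsf{C}\mathbb{D}_0$ is isomorphic to the suboperad of $\mathsf{MT}$ consisting in the linear span of all multi-tildes except the nontrivial multi-tilde $(1,\{(1,1)\})$ of arity $1$. Moreover, the linear map $\phi$ sending any multi-tilde $(n,\mathfrak{s})\ne(1,\{(1,1)\})$ to the $\mathbb{D}_0$-clique of arity $n$ defined, for any $1\le x<y\le n+1$, by $$\phi((n,\mathfrak{s}))(x,y):=\begin{cases}0&\text{if }(x,y-1)\in\mathfrak{s},\\ \mathds{1}&\text{otherwise,}\end{cases}$$ is an isomorphism between these two operads.
   Context: All vector spaces are over a field $\mathbb{K}$ of characteristic zero; $[n]=\{1,\dots,n\}$. Operad means nonsymmetric operad in vector spaces, graded by arities $n\ge1$. $\mathbb{D}_0=\{\mathds{1},0\}$ is the unitary magma with unit $\mathds{1}$ and absorbing element $0$ (so $0\star0=0$). A $\mathbb{D}_0$-clique $\mathfrak{p}$ of arity $n\ge1$ is a map assigning to every arc $(x,y)$, $1\le x<y\le n+1$, a label $\mathfrak{p}(x,y)\in\mathbb{D}_0$; by convention, the only $\mathbb{D}_0$-clique of arity $1$ is the one with $\mathfrak{p}(1,2)=\mathds{1}$. Put $\mathfrak{p}_0:=\mathfrak{p}(1,n+1)$ and $\mathfrak{p}_i:=\mathfrak{p}(i,i+1)$ for $i\in[n]$. $\mathsf{C}\mathbb{D}_0$ is the operad whose space $\mathsf{C}\mathbb{D}_0(n)$ is the linear span of all $\mathbb{D}_0$-cliques of arity $n$, whose unit is the unique $\mathbb{D}_0$-clique of arity $1$, and where,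 for $\mathfrak{p},\mathfrak{q}$ of arities $n,m$ and $i\in[n]$, $$(\mathfrak{p}\circ_i\mathfrak{q})(x,y)=\begin{cases}\mathfrak{p}(x,y)&\text{if }y\le i,\\ \mathfrak{p}(x,y-m+1)&\text{if }x\le i<i+m\le y,\ (x,y)\ne(i,i+m),\\ \mathfrak{p}(x-m+1,y-m+1)&\text{if }i+m\le x,\\ \mathfrak{q}(x-i+1,y-i+1)&\text{if }i\le x<y\le i+m,\ (x,y)\ne(i,i+m),\\ \mathfrak{p}_i\star\mathfrak{q}_0&\text{if }(x,y)=(i,i+m),\\ \mathds{1}&\text{otherwise.}\end{cases}$$ A multi-tilde of arity $n$ is a pair $(n,\mathfrak{s})$ with $n\ge1$ and $\mathfrak{s}\subseteq\{(x,y)\in[n]^2:x\le y\}$. $\mathsf{MT}$ is the operad where $\mathsf{MT}(n)$ is the linear span of all multi-tildes of arity $n$, with unit $(1,\emptyset)$ and, for $i\in[n]$, $$(n,\mathfrak{s})\circ_i(m,\mathfrak{t}):=\big(n+m-1,\ \{\mathrm{sh}_{i,m}(x,y):(x,y)\in\mathfrak{s}\}\cup\{\mathrm{sh}_{0,i}(x,y):(x,y)\in\mathfrak{t}\}\big),$$ where $\mathrm{sh}_{j,p}(x,y):=(x,y)$ if $y\le j-1$; $(x,y+p-1)$ if $x\le j\le y$; and $(x+p-1,y+p-1)$ otherwise. (Thus $\mathrm{sh}_{0,i}(x,y)=(x+i-1,y+i-1)$.) *)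

(* Defs.v *)
From HB Require Import structures.
From mathcomp Require Import all_boot all_order all_algebra.
From mathcomp Require Import zify.

Set Implicit Arguments.
Unset Strict Implicit.
Unset Printing Implicit Defensive.

Import GRing.Theory.
Local Open Scope ring_scope.

(* Arities start at 1: throughout, the index n stands for the arity n.+1, so *)
(* that grafting arities n.+1 and m.+1 gives (n + m).+1.  A grafting position *)
(* i : 'I_n.+1 is 0-based and denotes the i.+1-st input.  Identities between *)
(* elements of components whose indices are only provably equal are stated in *)
(* the total space {n & O n}, as Tagged O u = Tagged O v. *)

Record operad (K : fieldType) := Operad {
  op_space :> nat -> lmodType K;
  op_one : op_space 0;
  op_comp : forall n m, op_space n -> 'I_n.+1 -> op_space m -> op_space (n + m);
  op_linearl : forall n m (i : 'I_n.+1) (y : op_space m),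
    linear (fun x : op_space n => op_comp x i y);
  op_linearr : forall n m (i : 'I_n.+1) (x : op_space n),
    linear (fun y : op_space m => op_comp x i y);
  op_comp1x : forall m (i : 'I_1) (x : op_space m),
    Tagged op_space (op_comp op_one i x) = Tagged op_space x;
  op_compx1 : forall n (i : 'I_n.+1) (x : op_space n),
    Tagged op_space (op_comp x i op_one) = Tagged op_space x;
  op_seq : forall n m l (x : op_space n) (y : op_space m) (z : op_space l)
      (i : 'I_n.+1) (j : 'I_m.+1) (k : 'I_(n + m).+1),
    k = (i + j)%N :> nat ->
    Tagged op_space (op_comp (op_comp x i y) k z)
      = Tagged op_space (op_comp x i (op_comp y j z));
  op_par : forall n m l (x : op_space n) (y : op_space m) (z : op_space l)
      (i j : 'I_n.+1) (j' : 'I_(n + m).+1) (i' : 'I_(n + l).+1),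
    (i < j)%N -> j' = (j + m)%N :> nat -> i' = i :> nat ->
    Tagged op_space (op_comp (op_comp x i y) j' z)
      = Tagged op_space (op_comp (op_comp x j z) i' y)
}.

Arguments op_one {K} o.
Arguments op_comp {K} o {n m} x i y.

Record operad_morphism (K : fieldType) (O P : operad K)
    (f : forall n, O n -> P n) : Prop := {
  morph_linear : forall n, linear (f n);
  morph_one : f 0 (op_one O) = op_one P;
  morph_comp : forall n m (x : O n) (i : 'I_n.+1) (y : O m),
    f (n + m)%N (op_comp O x i y) = op_comp P (f n x) i (f m y)
}.

Definition operad_isomorphism (K : fieldType) (O P : operad K)
    (f : forall n, O n -> P n) : Prop :=
  operad_morphism f /\ forall n, bijective (f n).

Definition isomorphic_operads (K : fieldType) (O P : operad K) : Prop :=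
  exists f : forall n, O n -> P n, operad_isomorphism f.

Record is_suboperad (K : fieldType) (O : operad K) (S : forall n, {pred O n}) :
    Prop := {
  sub_submod : forall n, submod_closed (S n);
  sub_one : op_one O \in S 0;
  sub_comp : forall n m (x : O n) (i : 'I_n.+1) (y : O m),
    x \in S n -> y \in S m -> op_comp O x i y \in S (n + m)%N
}.

Section Suboperad.

Variables (K : fieldType) (O : operad K) (S : forall n, {pred O n}).
Hypothesis subS : is_suboperad S.

Definition sub_pred (_ : is_suboperad S) (n : nat) : {pred O n} := @S n.
Arguments sub_pred : clear implicits.

HB.instance Definition _ n := GRing.isSubmodClosed.Build K (O n)
  (sub_pred subS n) (@sub_submod _ _ _ subS n).

Definition sub_space n := {x : O n | x \in sub_pred subS n}.

HB.instance Definition _ n := SubChoice.on (sub_space n).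
HB.instance Definition _ n := [SubChoice_isSubLmodule of sub_space n by <:].

Definition sub_one_elt : sub_space 0 := Sub (op_one O) (sub_one subS).

Definition sub_comp_elt n m (x : sub_space n) (i : 'I_n.+1) (y : sub_space m) :
    sub_space (n + m) :=
  Sub (op_comp O (val x) i (val y)) (sub_comp subS i (valP x) (valP y)).

Lemma Tagged_sub n n' (x : sub_space n) (y : sub_space n') :
  Tagged (fun k => O k) (val x) = Tagged (fun k => O k) (val y) ->
  Tagged sub_space x = Tagged sub_space y.
Proof.
move=> e; have enn : n = n' := congr1 tag e.
case: _ / enn y e => y e; congr (Tagged _ _); apply/val_inj.
by move/eqP: e; rewrite -tag_eqE /tag_eq eqxx /= tagged_asE => /eqP.
Qed.

Fact sub_linearl n m (i : 'I_n.+1) (y : sub_space m) :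
  linear (fun x : sub_space n => sub_comp_elt x i y).
Proof. by move=> a u v; apply/val_inj; rewrite /= op_linearl. Qed.

Fact sub_linearr n m (i : 'I_n.+1) (x : sub_space n) :
  linear (fun y : sub_space m => sub_comp_elt x i y).
Proof. by move=> a u v; apply/val_inj; rewrite /= op_linearr. Qed.

Definition suboperad : operad K.
Proof.
apply: (@Operad K (fun n => sub_space n : lmodType K) sub_one_elt sub_comp_elt
          sub_linearl sub_linearr).
- by move=> *; apply/Tagged_sub/op_comp1x.
- by move=> *; apply/Tagged_sub/op_compx1.
- by move=> *; apply/Tagged_sub/op_seq.
- by move=> n m l x y z i j j' i' *; apply/Tagged_sub/(@op_par _ O) => //.
Defined.

End Suboperad.

Arguments suboperad {K O S} subS.

(* A nonsymmetric operad in finite sets, to be extended by linearity. *)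
Record set_operad := SetOperad {
  so_set :> nat -> finType;
  so_one : so_set 0;
  so_comp : forall n m, so_set n -> 'I_n.+1 -> so_set m -> so_set (n + m);
  so_comp1x : forall m (i : 'I_1) (x : so_set m),
    Tagged so_set (so_comp so_one i x) = Tagged so_set x;
  so_compx1 : forall n (i : 'I_n.+1) (x : so_set n),
    Tagged so_set (so_comp x i so_one) = Tagged so_set x;
  so_seq : forall n m l (x : so_set n) (y : so_set m) (z : so_set l)
      (i : 'I_n.+1) (j : 'I_m.+1) (k : 'I_(n + m).+1),
    k = (i + j)%N :> nat ->
    Tagged so_set (so_comp (so_comp x i y) k z)
      = Tagged so_set (so_comp x i (so_comp y j z));
  so_par : forall n m l (x : so_set n) (y : so_set m) (z : so_set l)
      (i j : 'I_n.+1) (j' : 'I_(n + m).+1) (i' : 'I_(n + l).+1),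
    (i < j)%N -> j' = (j + m)%N :> nat -> i' = i :> nat ->
    Tagged so_set (so_comp (so_comp x i y) j' z)
      = Tagged so_set (so_comp (so_comp x j z) i' y)
}.

Arguments so_one P : rename.
Arguments so_comp P {n m} x i y : rename.

Definition free_space (K : fieldType) (B : finType) := {ffun B -> K^o}.
HB.instance Definition _ (K : fieldType) (B : finType) :=
  Vector.on (free_space K B).

Definition basis (K : fieldType) (B : finType) (b : B) : free_space K B :=
  [ffun x => (x == b)%:R].
Arguments basis K {B} b.

Section Linearization.

Variables (K : fieldType) (P : set_operad).

Local Notation lin n := (free_space K (P n)).

Definition lin_comp n m (f : lin n) (i : 'I_n.+1) (g : lin m) : lin (n + m) :=
  \sum_(p : P n) \sum_(q : P m) (f p * g q) *: basis K (so_comp P p i q).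

Fact lin_linearl n m (i : 'I_n.+1) (g : lin m) :
  linear (fun f : lin n => lin_comp f i g).
Proof.
move=> a u v; rewrite /lin_comp scaler_sumr -big_split; apply: eq_bigr => p _.
rewrite scaler_sumr -big_split; apply: eq_bigr => q _ /=.
by rewrite !ffunE scalerA -scalerDl mulrDl mulrA.
Qed.

Fact lin_linearr n m (i : 'I_n.+1) (f : lin n) :
  linear (fun g : lin m => lin_comp f i g).
Proof.
move=> a u v; rewrite /lin_comp scaler_sumr -big_split; apply: eq_bigr => p _.
rewrite scaler_sumr -big_split; apply: eq_bigr => q _ /=.
by rewrite !ffunE scalerA -scalerDl mulrDr mulrCA.
Qed.

Lemma lin_compE n m (p : P n) (i : 'I_n.+1) (q : P m) :
  lin_comp (basis K p) i (basis K q) = basis K (so_comp P p i q).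
Proof.
rewrite /lin_comp (bigD1 p) //= (bigD1 q) //= !ffunE !eqxx mulr1 scale1r.
rewrite !big1 ?addr0 // => [p' np | q' nq]; last first.
  by rewrite !ffunE (negPf nq) mulr0 scale0r.
by rewrite big1 // => q' _; rewrite !ffunE (negPf np) mul0r scale0r.
Qed.

Lemma free_decomp (B : finType) (f : free_space K B) :
  f = \sum_b f b *: basis K b.
Proof.
apply/ffunP => x; rewrite sum_ffunE (bigD1 x) //= !ffunE eqxx.
rewrite big1 => [|b nb]; first by rewrite addr0 /GRing.scale /= mulr1.
by rewrite !ffunE eq_sym (negPf nb) scaler0.
Qed.

Lemma Tagged_inj n (x y : P n) :
  Tagged (fun k => P k) x = Tagged (fun k => P k) y -> x = y.
Proof. by move/eqP; rewrite -tag_eqE /tag_eq eqxx /= tagged_asE => /eqP. Qed.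

Lemma Tagged_lin N N' (I : finType) (c : I -> K) (A : I -> P N) (B : I -> P N') :
  N = N' -> (forall t, Tagged (fun k => P k) (A t) = Tagged (fun k => P k) (B t)) ->
  Tagged (fun n => lin n) (\sum_t c t *: basis K (A t))
    = Tagged (fun n => lin n) (\sum_t c t *: basis K (B t)).
Proof.
move=> e; case: _ / e B => B AB; congr (Tagged _ _); apply: eq_bigr => t _.
by rewrite (Tagged_inj (AB t)) .
Qed.

Lemma lin_suml n m (I : finType) (a : I -> K) (u : I -> lin n) (i : 'I_n.+1)
    (g : lin m) :
  lin_comp (\sum_s a s *: u s) i g = \sum_s a s *: lin_comp (u s) i g.
Proof.
pose L : {linear lin n -> lin (n + m)} :=
  HB.pack (fun f => lin_comp f i g)
    (GRing.isLinear.Build _ _ _ _ (fun f => lin_comp f i g) (lin_linearl i g)).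
by rewrite -[LHS]/(L _) linear_sum; apply: eq_bigr => s _; rewrite linearZZ.
Qed.

Lemma lin_sumr n m (I : finType) (a : I -> K) (u : I -> lin m) (i : 'I_n.+1)
    (f : lin n) :
  lin_comp f i (\sum_s a s *: u s) = \sum_s a s *: lin_comp f i (u s).
Proof.
pose L : {linear lin m -> lin (n + m)} :=
  HB.pack (fun g => lin_comp f i g)
    (GRing.isLinear.Build _ _ _ _ (fun g => lin_comp f i g) (lin_linearr i f)).
by rewrite -[LHS]/(L _) linear_sum; apply: eq_bigr => s _; rewrite linearZZ.
Qed.

Lemma lin_comp_sum n m (I J : finType) (a : I -> K) (b : J -> K)
    (A : I -> P n) (B : J -> P m) (i : 'I_n.+1) :
  lin_comp (\sum_s a s *: basis K (A s)) i (\sum_t b t *: basis K (B t))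
    = \sum_(st : I * J) (a st.1 * b st.2) *: basis K (so_comp P (A st.1) i (B st.2)).
Proof.
rewrite -(pair_bigA _ (fun s t => (a s * b t) *:
  basis K (so_comp P (A s) i (B t)))) /= lin_suml.
apply: eq_bigr => s _; rewrite lin_sumr scaler_sumr.
by apply: eq_bigr => t _; rewrite lin_compE scalerA.
Qed.

Lemma lin_sum1 n (f : lin n) : f = \sum_p f p *: basis K (id p).
Proof. exact: free_decomp. Qed.

Definition linearization : operad K.
Proof.
apply: (@Operad K (fun n => lin n : lmodType K) (basis K (so_one P)) lin_comp
          lin_linearl lin_linearr).
- move=> m i x; rewrite (lin_sum1 x) lin_sumr.
  under eq_bigr do rewrite lin_compE.
  by apply: Tagged_lin => // q; apply: so_comp1x.
- move=> n i x; rewrite (lin_sum1 x) lin_suml.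
  under eq_bigr do rewrite lin_compE.
  by apply: Tagged_lin => [|p]; [exact: addn0 | exact: so_compx1].
- move=> n m l x y z i j k kE.
  rewrite (lin_sum1 x) (lin_sum1 y) (lin_sum1 z) !lin_comp_sum.
  rewrite (reindex (fun t : (P n * P m) * P l => (t.1.1, (t.1.2, t.2)))) /=; last first.
    by exists (fun t => ((t.1, t.2.1), t.2.2)) => [[[]]|[? []]].
  under [in RHS]eq_bigr do rewrite mulrA.
  apply: (@Tagged_lin _ _ _ (fun t => x t.1.1 * y t.1.2 * z t.2)) => [|t].
    by rewrite addnA.
  exact: so_seq.
- move=> n m l x y z i j j' i' ij j'E i'E.
  rewrite (lin_sum1 x) (lin_sum1 y) (lin_sum1 z) !lin_comp_sum.
  rewrite [in RHS](reindex (fun t : (P n * P m) * P l => ((t.1.1, t.2), t.1.2))) /=; last first.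
    by exists (fun t => ((t.1.1, t.2), t.1.2)) => [[[]]|[[]]].
  under [in RHS]eq_bigr do rewrite mulrAC.
  apply: (@Tagged_lin _ _ _ (fun t => x t.1.1 * y t.1.2 * z t.2)) => [|t].
    by rewrite addnAC.
  exact: so_par.
Defined.

End Linearization.

Inductive D0 := D0_one | D0_zero.

Definition D0_mul (a b : D0) : D0 :=
  match a, b with
  | D0_one, _ => b
  | D0_zero, _ => D0_zero
  end.

Definition bool_of_D0 (a : D0) : bool := if a is D0_one then true else false.
Definition D0_of_bool (b : bool) : D0 := if b then D0_one else D0_zero.
Lemma bool_of_D0K : cancel bool_of_D0 D0_of_bool. Proof. by case. Qed.
HB.instance Definition _ := Finite.copy D0 (can_type bool_of_D0K).

(* Arcs (x, y), 1 <= x < y <= n + 2, of the polygon of a clique of arity n.+1. *)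
Definition arc (n : nat) := {a : 'I_n.+3 * 'I_n.+3 | (0 < a.1 < a.2)%N}.

(* The second component is the convention that the only clique of arity 1 has *)
(* its unique arc labelled by the unit. *)
Definition clique (n : nat) :=
  {p : {ffun arc n -> D0} | (n == 0)%N ==> [forall a, p a == D0_one]}.

(* The label p(x, y) for 1-based vertices, equal to D0_one off the arcs. *)
Definition lab n (p : clique n) (x y : nat) : D0 :=
  if insub (inord x, inord y) : option (arc n) is Some a then val p a
  else D0_one.

(* The label of (x, y) in p o_i q for q of arity m. *)
Definition graft (p q : nat -> nat -> D0) (i m x y : nat) : D0 :=
  if (y <= i)%N then p x y
  else if [&& x <= i, i + m <= y & (x, y) != (i, i + m)]%N then p x (y - m + 1)%N
  else if (i + m <= x)%N then p (x - m + 1)%N (y - m + 1)%N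
  else if [&& i <= x, x < y, y <= i + m & (x, y) != (i, i + m)]%N then
    q (x - i + 1)%N (y - i + 1)%N
  else if (x, y) == (i, i + m)%N then D0_mul (p i (i + 1)%N) (q 1 (m + 1))%N
  else D0_one.

Lemma lab_arity1 (p : clique 0) x y : lab p x y = D0_one.
Proof.
rewrite /lab; case: insub => // a.
by have /= /forallP/(_ a)/eqP := valP p.
Qed.

Lemma graft_one i m x y :
  graft (fun _ _ => D0_one) (fun _ _ => D0_one) i m x y = D0_one.
Proof. by rewrite /graft; do !case: ifP. Qed.

Definition clique_one : clique 0.
Proof.
exists [ffun=> D0_one]; apply/implyP => _; apply/forallP => a.
by rewrite ffunE.
Defined.

Definition clique_comp_lab n m (p : clique n) (i : 'I_n.+1) (q : clique m) :
    {ffun arc (n + m) -> D0} :=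
  [ffun a : arc (n + m) => graft (lab p) (lab q) i.+1 m.+1 (val a).1 (val a).2].

Lemma clique_comp_subproof n m (p : clique n) (i : 'I_n.+1) (q : clique m) :
  (n + m == 0)%N ==> [forall a, clique_comp_lab p i q a == D0_one].
Proof.
apply/implyP; rewrite addn_eq0 => /andP[/eqP n0 /eqP m0]; apply/forallP => a.
rewrite ffunE; move: p i q a; rewrite n0 m0 => p i q a.
apply/eqP; rewrite -[RHS](graft_one i.+1 1 (val a).1 (val a).2) /graft.
by rewrite !lab_arity1.
Qed.

Definition clique_comp n m (p : clique n) (i : 'I_n.+1) (q : clique m) :
    clique (n + m) :=
  exist _ (clique_comp_lab p i q) (clique_comp_subproof p i q).

Lemma labE n (p : clique n) (a : arc n) : lab p (val a).1 (val a).2 = val p a.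
Proof.
rewrite /lab !inord_val -surjective_pairing valK //.
Qed.

Lemma clique_ext n n' (p : clique n) (p' : clique n') :
  n = n' ->
  (forall x y, (0 < x < y)%N -> (y <= n.+2)%N -> lab p x y = lab p' x y) ->
  Tagged clique p = Tagged clique p'.
Proof.
move=> e; case: _ / e p' => p' E; congr (Tagged _ _); apply/val_inj/ffunP => a.
rewrite -!labE; apply: E; first exact: (valP a).
by rewrite -ltnS.
Qed.

Lemma lab_comp n m (p : clique n) (i : 'I_n.+1) (q : clique m) x y :
  (0 < x < y)%N -> (y <= (n + m).+2)%N ->
  lab (clique_comp p i q) x y = graft (lab p) (lab q) i.+1 m.+1 x y.
Proof.
move=> xy yn.
have x_ok : (x < (n + m).+3)%N by lia.
have y_ok : (y < (n + m).+3)%N by lia.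
pose a : arc (n + m) := exist _ (Ordinal x_ok, Ordinal y_ok) xy.
by rewrite -[x in LHS]/(nat_of_ord (val a).1) -[y in LHS]/(nat_of_ord (val a).2) labE /= ffunE.
Qed.

Lemma eq_graft (p p' q q' : nat -> nat -> D0) n m i x y :
  (0 < i <= n.+1)%N -> (0 < x < y)%N -> (y <= (n + m).+2)%N ->
  (forall x y, (0 < x < y)%N -> (y <= n.+2)%N -> p x y = p' x y) ->
  (forall x y, (0 < x < y)%N -> (y <= m.+2)%N -> q x y = q' x y) ->
  graft p q i m.+1 x y = graft p' q' i m.+1 x y.
Proof.
move=> hi hx hy Ep Eq; rewrite /graft !xpair_eqE.
do ![case: ifP => ?]; rewrite ?Ep ?Eq //; lia.
Qed.

Variant graft_spec (p q : nat -> nat -> D0) (i m x y : nat) : D0 -> Prop :=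
  | GraftL of (y <= i)%coq_nat : graft_spec p q i m x y (p x y)
  | GraftM of (x <= i)%coq_nat & (i + m <= y)%coq_nat
      & (x < i \/ i + m < y)%coq_nat : graft_spec p q i m x y (p x (y - m + 1)%N)
  | GraftR of (i + m <= x)%coq_nat :
      graft_spec p q i m x y (p (x - m + 1)%N (y - m + 1)%N)
  | GraftI of (i <= x)%coq_nat & (y <= i + m)%coq_nat
      & (i < x \/ y < i + m)%coq_nat :
      graft_spec p q i m x y (q (x - i + 1)%N (y - i + 1)%N)
  | GraftE of x = i & y = (i + m)%N :
      graft_spec p q i m x y (D0_mul (p i (i + 1)%N) (q 1%N (m + 1)%N))
  | GraftX of ((x < i /\ i < y /\ y < i + m)
               \/ (i < x /\ x < i + m /\ i + m < y))%coq_nat :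
      graft_spec p q i m x y D0_one.

Lemma graftP p q i m x y : (0 < m)%coq_nat -> (x < y)%coq_nat ->
  graft_spec p q i m x y (graft p q i m x y).
Proof.
move=> hm hx; rewrite /graft !xpair_eqE.
case: ifP => ?; first by constructor; lia.
case: ifP => ?; first by constructor; lia.
case: ifP => ?; first by constructor; lia.
case: ifP => ?; first by constructor; lia.
case: ifP => ?; last by constructor; lia.
have -> : x = i by lia.
have -> : y = (i + m)%N by lia.
by constructor.
Qed.

Arguments graftP : clear implicits.
Ltac graft_case :=
  match goal with
  | |- context [graft ?p ?q ?i ?m ?x ?y] =>
    lazymatch p with context [graft] => fail | _ => idtac end;
    lazymatch q with context [graft] => fail | _ => idtac end;
    case: (graftP p q i m x y); try (intros; exfalso; lia); intros
  end.

Lemma D0_mulA : associative D0_mul. Proof. by case. Qed.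
Lemma D0_mul1 : right_id D0_one D0_mul. Proof. by case. Qed.


Lemma graft_seq (p q r : nat -> nat -> D0) i j m l x y :
  (0 < i)%coq_nat -> (0 < j)%coq_nat -> (j <= m)%coq_nat -> (0 < l)%coq_nat ->
  (x < y)%coq_nat ->
  graft (graft p q i m) r (i + j - 1) l x y
    = graft p (graft q r j l) i (m + l - 1) x y.
Proof.
move=> hi hj hjm hl hx.
case: (graftP (graft p q i m) r (i + j - 1)%N l x y);
  try (intros; exfalso; lia); intros.
all: case: (graftP p (graft q r j l) i (m + l - 1)%N x y);
  try (intros; exfalso; lia); intros.
all: repeat graft_case.
all: rewrite -?D0_mulA.
all: by repeat (reflexivity || lia || f_equal).
Qed.

Lemma graft_par (p q r : nat -> nat -> D0) i j m l x y :
  (0 < i)%coq_nat -> (i < j)%coq_nat -> (0 < m)%coq_nat -> (0 < l)%coq_nat ->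
  (x < y)%coq_nat ->
  graft (graft p q i m) r (j + m - 1) l x y
    = graft (graft p r j l) q i m x y.
Proof.
move=> hi hj hm hl hx.
case: (graftP (graft p q i m) r (j + m - 1)%N l x y);
  try (intros; exfalso; lia); intros.
all: case: (graftP (graft p r j l) q i m x y);
  try (intros; exfalso; lia); intros.
all: repeat graft_case.
all: by repeat (reflexivity || lia || f_equal).
Qed.

Lemma graft1x q m x y : (0 < x)%coq_nat -> (x < y)%coq_nat ->
  (y <= m + 1)%coq_nat -> graft (fun _ _ => D0_one) q 1 m x y = q x y.
Proof.
move=> hx hy hm; case: graftP; try (intros; lia).
- by move=> *; congr q; lia.
- by move=> -> ->; congr q; lia.
Qed.

Lemma graftx1 p i x y : (x < y)%coq_nat ->
  graft p (fun _ _ => D0_one) i 1 x y = p x y.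
Proof.
move=> hy; case: graftP; try (intros; lia).
- by [].
- by move=> *; congr p; lia.
- by move=> *; congr p; lia.
- by move=> -> ->; rewrite D0_mul1.
Qed.

Lemma clique_comp1x m (i : 'I_1) (p : clique m) :
  Tagged clique (clique_comp clique_one i p) = Tagged clique p.
Proof.
apply: clique_ext => // x y hx hy; rewrite lab_comp //.
have -> : (i : nat).+1 = 1%N by rewrite (ord1 i).
rewrite (@eq_graft _ (fun _ _ => D0_one) _ (lab p) 0 m) //; last first.
  by move=> ? ? _ _; exact: lab_arity1.
by apply: graft1x; lia.
Qed.

Lemma clique_compx1 n (i : 'I_n.+1) (p : clique n) :
  Tagged clique (clique_comp p i clique_one) = Tagged clique p.
Proof.
apply: clique_ext => [|x y hx hy]; first exact: addn0.
rewrite lab_comp // (@eq_graft _ (lab p) _ (fun _ _ => D0_one) n 0) //.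
- by apply: graftx1; lia.
- by have := ltn_ord i.
- by move=> ? ? _ _; exact: lab_arity1.
Qed.

Lemma clique_seq n m l (p : clique n) (q : clique m) (r : clique l)
    (i : 'I_n.+1) (j : 'I_m.+1) (k : 'I_(n + m).+1) :
  k = (i + j)%N :> nat ->
  Tagged clique (clique_comp (clique_comp p i q) k r)
    = Tagged clique (clique_comp p i (clique_comp q j r)).
Proof.
move=> kE; have [[li lj] lk] := (ltn_ord i, ltn_ord j, ltn_ord k).
apply: clique_ext => [|x y hx hy]; first by rewrite addnA.
rewrite lab_comp // lab_comp ?addnA //.
rewrite (@eq_graft _ (graft (lab p) (lab q) i.+1 m.+1) _ (lab r) (n + m) l) //;
  last by move=> *; apply: lab_comp.
rewrite [RHS](@eq_graft _ (lab p) _ (graft (lab q) (lab r) j.+1 l.+1) n (m + l)) //;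
  [| by lia | by move=> *; apply: lab_comp].
have -> : (k.+1 = i.+1 + j.+1 - 1)%N by lia.
have -> : ((m + l).+1 = m.+1 + l.+1 - 1)%N by lia.
by apply: graft_seq; lia.
Qed.

Lemma clique_par n m l (p : clique n) (q : clique m) (r : clique l)
    (i j : 'I_n.+1) (j' : 'I_(n + m).+1) (i' : 'I_(n + l).+1) :
  (i < j)%N -> j' = (j + m)%N :> nat -> i' = i :> nat ->
  Tagged clique (clique_comp (clique_comp p i q) j' r)
    = Tagged clique (clique_comp (clique_comp p j r) i' q).
Proof.
move=> ij jE iE; have [li lj] := (ltn_ord i, ltn_ord j).
apply: clique_ext => [|x y hx hy]; first by rewrite addnAC.
rewrite lab_comp // lab_comp; [| by [] | by lia].
rewrite (@eq_graft _ (graft (lab p) (lab q) i.+1 m.+1) _ (lab r) (n + m) l) //;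
  [| by lia | by move=> *; apply: lab_comp].
rewrite [RHS](@eq_graft _ (graft (lab p) (lab r) j.+1 l.+1) _ (lab q) (n + l) m) //;
  [| by lia | by lia | by move=> *; apply: lab_comp].
have -> : (j'.+1 = j.+1 + m.+1 - 1)%N by lia.
by rewrite iE; apply: graft_par; lia.
Qed.

Definition clique_set_operad : set_operad :=
  @SetOperad clique clique_one clique_comp
    clique_comp1x clique_compx1 clique_seq clique_par.

Definition CD0 (K : fieldType) : operad K := linearization K clique_set_operad.

(* The pairs (x, y), 1 <= x <= y <= n.+1, that may belong to a multi-tilde of *)
(* arity n.+1. *)
Definition tilde (n : nat) := {a : 'I_n.+2 * 'I_n.+2 | (0 < a.1 <= a.2)%N}.

Definition multitilde (n : nat) := {set tilde n}.

Definition coords n (a : tilde n) : nat * nat :=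
  (nat_of_ord (val a).1, nat_of_ord (val a).2).

(* sh_{j,p}; the condition y <= j - 1, over the integers, is y < j. *)
Definition sh (j p : nat) (a : nat * nat) : nat * nat :=
  let: (x, y) := a in
  if (y < j)%N then (x, y)
  else if (x <= j <= y)%N then (x, y + p - 1)%N
  else (x + p - 1, y + p - 1)%N.

Definition multitilde_one : multitilde 0 := set0.

Definition multitilde_comp n m (s : multitilde n) (i : 'I_n.+1)
    (t : multitilde m) : multitilde (n + m) :=
  [set c | (coords c \in [seq sh i.+1 m.+1 (coords a) | a in s])
        || (coords c \in [seq sh 0 i.+1 (coords b) | b in t])].

Definition has_tilde n (s : multitilde n) (x y : nat) : bool :=
  [exists a in s, coords a == (x, y)].

(* The label 0 if (x, y - 1) belongs to s, and 1 otherwise. *)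
Definition tilde_lab n (s : multitilde n) (x y : nat) : D0 :=
  if has_tilde s x (y - 1) then D0_zero else D0_one.

Lemma has_tilde_coords n (s : multitilde n) (a : tilde n) :
  has_tilde s (coords a).1 (coords a).2 = (a \in s).
Proof.
apply/exists_inP/idP => [[b bs]|a_s]; last by exists a => //=.
rewrite -surjective_pairing => /eqP [/val_inj e1 /val_inj e2].
have <- // : b = a; apply/val_inj.
by rewrite [LHS]surjective_pairing e1 e2 -surjective_pairing.
Qed.

Lemma has_tilde_bound n (s : multitilde n) x y :
  has_tilde s x y -> (0 < x <= y)%N && (y <= n.+1)%N.
Proof.
case/exists_inP => a _ /eqP [<- <-]; apply/andP; split; first exact: (valP a).
by rewrite -ltnS ltn_ord.
Qed.

Lemma tildeE n x y : (0 < x <= y)%N -> (y <= n.+1)%N ->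
  exists a : tilde n, coords a = (x, y).
Proof.
move=> xy yn; have x_ok : (x < n.+2)%N by lia.
have y_ok : (y < n.+2)%N by lia.
by exists (exist _ (Ordinal x_ok, Ordinal y_ok) xy).
Qed.

Lemma has_tilde_comp n m (s : multitilde n) (i : 'I_n.+1) (t : multitilde m) x y :
  (0 < x <= y)%N -> (y <= (n + m).+1)%N ->
  reflect ((exists a b, has_tilde s a b /\ sh i.+1 m.+1 (a, b) = (x, y))
       \/ exists a b, has_tilde t a b /\ sh 0 i.+1 (a, b) = (x, y))
    (has_tilde (multitilde_comp s i t) x y).
Proof.
move=> xy yn.
suff E : has_tilde (multitilde_comp s i t) x y <->
    (exists a b, has_tilde s a b /\ sh i.+1 m.+1 (a, b) = (x, y))
    \/ exists a b, has_tilde t a b /\ sh 0 i.+1 (a, b) = (x, y).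
  by apply: (iffP idP) => /E.
have [c cE] := tildeE xy yn.
rewrite -[x in has_tilde _ x]/(x, y).1 -[y in has_tilde _ _ y]/(x, y).2 -cE.
rewrite has_tilde_coords inE; split=> [/orP|H]; last (apply/orP; move: H).
- case=> /imageP[a ha ->]; [left|right]; exists (coords a).1, (coords a).2.
    by rewrite has_tilde_coords -surjective_pairing.
  by rewrite has_tilde_coords -surjective_pairing.
- case=> [[a [b [hab <-]]]|[a [b [hab <-]]]]; [left|right].
    have /andP[h1 h2] := has_tilde_bound hab; have [d dE] := tildeE h1 h2.
    apply/imageP; exists d; last by rewrite dE.
    by move: hab; rewrite -[a]/(a, b).1 -[b in has_tilde _ _ b]/(a, b).2 -dE
         has_tilde_coords.
  have /andP[h1 h2] := has_tilde_bound hab; have [d dE] := tildeE h1 h2.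
  apply/imageP; exists d; last by rewrite dE.
  by move: hab; rewrite -[a]/(a, b).1 -[b in has_tilde _ _ b]/(a, b).2 -dE
       has_tilde_coords.
Qed.

Lemma has_tilde_compE n m (s : multitilde n) (i : 'I_n.+1) (t : multitilde m) x y :
  (0 < x <= y)%N -> (y <= (n + m).+1)%N ->
  has_tilde (multitilde_comp s i t) x y
    = [|| (y < i.+1)%N && has_tilde s x y,
          (x <= i.+1 <= y - m)%N && has_tilde s x (y - m),
          (i.+1 + m < x)%N && has_tilde s (x - m) (y - m)
        | (i.+1 <= x)%N && has_tilde t (x - i) (y - i)].
Proof.
move=> hx hy; apply/(has_tilde_comp s i t hx hy)/or4P; last first.
  case=> /andP[h1 h2].
  - by left; exists x, y; rewrite /sh h1.
  - left; exists x, (y - m)%N; split => //; rewrite /sh h1.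
    have -> : (y - m < i.+1)%N = false by lia.
    by congr pair; lia.
  - left; exists (x - m)%N, (y - m)%N; split => //; rewrite /sh.
    have -> : (y - m < i.+1)%N = false by lia.
    have -> : (x - m <= i.+1 <= y - m)%N = false by lia.
    by congr pair; lia.
  - right; exists (x - i)%N, (y - i)%N; split => //; rewrite /sh ltn0.
    have /andP[h3 _] := has_tilde_bound h2.
    have -> : (x - i <= 0 <= y - i)%N = false by lia.
    by congr pair; lia.
case=> [[a [b [hab]]]|[a [b [hab]]]];
  have /andP[h1 h2] := has_tilde_bound hab; rewrite /sh.
- case: ifP => h3; first by case=> <- <-; constructor 1; rewrite h3.
  case: ifP => h4 [<- <-]; [constructor 2|constructor 3].
    have -> : (b + m.+1 - 1 - m = b)%N by lia.
    by rewrite h4.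
  have -> : (b + m.+1 - 1 - m = b)%N by lia.
  have -> : (a + m.+1 - 1 - m = a)%N by lia.
  by rewrite hab andbT; lia.
- have -> : (b < 0)%N = false by lia.
  have -> : (a <= 0 <= b)%N = false by lia.
  case=> <- <-; constructor 4.
  have -> : (b + i.+1 - 1 - i = b)%N by lia.
  have -> : (a + i.+1 - 1 - i = a)%N by lia.
  by rewrite hab andbT; lia.
Qed.

Lemma tilde_lab_comp n m (s : multitilde n) (i : 'I_n.+1) (t : multitilde m) x y :
  (0 < x < y)%N -> (y <= (n + m).+2)%N ->
  tilde_lab (multitilde_comp s i t) x y
    = graft (tilde_lab s) (tilde_lab t) i.+1 m.+1 x y.
Proof.
move=> hx hy; have li := ltn_ord i.
rewrite {1}/tilde_lab has_tilde_compE; [|lia|lia].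
have Hs a b : ~~ ((0 < a <= b) && (b <= n.+1))%N -> has_tilde s a b = false.
  by move=> h; apply: contraNF h => /has_tilde_bound.
have Ht a b : ~~ ((0 < a <= b) && (b <= m.+1))%N -> has_tilde t a b = false.
  by move=> h; apply: contraNF h => /has_tilde_bound.
set g1 := (_ < i.+1)%N; set g2 := (_ <= _ <= _)%N; set g3 := (_ < x)%N.
set g4 := (_ <= x)%N.
case: graftP; rewrite /tilde_lab; try lia; intros.
- have [-> -> ->] : [/\ g1, g2 = false & g3 = false] by split; lia.
  have -> : g4 = false by lia.
  by rewrite orbF.
- have [-> -> ->] : [/\ g1 = false, g2 & g3 = false] by split; lia.
  have -> : (y - m.+1 + 1 - 1 = y - 1 - m)%N by lia.
  by case: g4; rewrite /= ?orbF // Ht ?orbF //; lia.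
- have [-> -> ->] : [/\ g1 = false, g2 = false & g3] by split; lia.
  have -> : (y - m.+1 + 1 - 1 = y - 1 - m)%N by lia.
  have -> : (x - m.+1 + 1 = x - m)%N by lia.
  by case: g4; rewrite /= ?orbF // Ht ?orbF //; lia.
- have [-> -> ->] : [/\ g1 = false, g2 = false & g3 = false] by split; lia.
  have -> : g4 by lia.
  have -> : (y - i.+1 + 1 - 1 = y - 1 - i)%N by lia.
  by have -> : (x - i.+1 + 1 = x - i)%N by lia.
- have [-> -> ->] : [/\ g1 = false, g2 & g3 = false] by split; lia.
  have -> : g4 by lia.
  have -> : (y - 1 - m = i.+1)%N by lia.
  have -> : (y - 1 - i = m.+1)%N by lia.
  have -> : (x - i = 1)%N by lia.
  have -> : x = i.+1 by lia.
  by rewrite !addn1 !subn1 /=; do !case: has_tilde.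
- have -> : g1 = false by lia.
  have [-> ->] : g2 = false /\ g3 = false by split; lia.
  by case: (boolP g4) => //= h4; rewrite Ht //; lia.
Qed.

Lemma multitilde_ext n n' (s : multitilde n) (s' : multitilde n') :
  n = n' ->
  (forall x y, (0 < x < y)%N -> (y <= n.+2)%N -> tilde_lab s x y = tilde_lab s' x y) ->
  Tagged multitilde s = Tagged multitilde s'.
Proof.
move=> e; case: _ / e s' => s' E; congr (Tagged _ _); apply/setP => a.
rewrite -!has_tilde_coords.
have := E (coords a).1 (coords a).2.+1; rewrite /tilde_lab subn1 /=.
have := valP a; have := ltn_ord (val a).2; rewrite /coords /= => h1 /andP[h2 h3].
rewrite h2 !ltnS in h1 h3 * => /(_ h3 h1).
by do 2!case: has_tilde.
Qed.

Lemma tilde_lab_one x y : tilde_lab multitilde_one x y = D0_one.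
Proof.
rewrite /tilde_lab; case: ifP => // /exists_inP[a].
by rewrite inE.
Qed.

Lemma multitilde_comp1x m (i : 'I_1) (p : multitilde m) :
  Tagged multitilde (multitilde_comp multitilde_one i p) = Tagged multitilde p.
Proof.
apply: multitilde_ext => // x y hx hy; rewrite tilde_lab_comp //.
have -> : (i : nat).+1 = 1%N by rewrite (ord1 i).
rewrite (@eq_graft _ (fun _ _ => D0_one) _ (tilde_lab p) 0 m) //; last first.
  by move=> ? ? _ _; exact: tilde_lab_one.
by apply: graft1x; lia.
Qed.

Lemma multitilde_compx1 n (i : 'I_n.+1) (p : multitilde n) :
  Tagged multitilde (multitilde_comp p i multitilde_one) = Tagged multitilde p.
Proof.
apply: multitilde_ext => [|x y hx hy]; first exact: addn0.
rewrite tilde_lab_comp // (@eq_graft _ (tilde_lab p) _ (fun _ _ => D0_one) n 0) //.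
- by apply: graftx1; lia.
- by have := ltn_ord i.
- by move=> ? ? _ _; exact: tilde_lab_one.
Qed.

Lemma multitilde_seq n m l (p : multitilde n) (q : multitilde m) (r : multitilde l)
    (i : 'I_n.+1) (j : 'I_m.+1) (k : 'I_(n + m).+1) :
  k = (i + j)%N :> nat ->
  Tagged multitilde (multitilde_comp (multitilde_comp p i q) k r)
    = Tagged multitilde (multitilde_comp p i (multitilde_comp q j r)).
Proof.
move=> kE; have [[li lj] lk] := (ltn_ord i, ltn_ord j, ltn_ord k).
apply: multitilde_ext => [|x y hx hy]; first by rewrite addnA.
rewrite tilde_lab_comp // tilde_lab_comp ?addnA //.
rewrite (@eq_graft _ (graft (tilde_lab p) (tilde_lab q) i.+1 m.+1) _ (tilde_lab r)
  (n + m) l) //; last by move=> *; apply: tilde_lab_comp.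
rewrite [RHS](@eq_graft _ (tilde_lab p) _
  (graft (tilde_lab q) (tilde_lab r) j.+1 l.+1) n (m + l)) //;
  [| by lia | by move=> *; apply: tilde_lab_comp].
have -> : (k.+1 = i.+1 + j.+1 - 1)%N by lia.
have -> : ((m + l).+1 = m.+1 + l.+1 - 1)%N by lia.
by apply: graft_seq; lia.
Qed.

Lemma multitilde_par n m l (p : multitilde n) (q : multitilde m) (r : multitilde l)
    (i j : 'I_n.+1) (j' : 'I_(n + m).+1) (i' : 'I_(n + l).+1) :
  (i < j)%N -> j' = (j + m)%N :> nat -> i' = i :> nat ->
  Tagged multitilde (multitilde_comp (multitilde_comp p i q) j' r)
    = Tagged multitilde (multitilde_comp (multitilde_comp p j r) i' q).
Proof.
move=> ij jE iE; have [li lj] := (ltn_ord i, ltn_ord j).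
apply: multitilde_ext => [|x y hx hy]; first by rewrite addnAC.
rewrite tilde_lab_comp // tilde_lab_comp; [| by [] | by lia].
rewrite (@eq_graft _ (graft (tilde_lab p) (tilde_lab q) i.+1 m.+1) _ (tilde_lab r)
  (n + m) l) //; [| by lia | by move=> *; apply: tilde_lab_comp].
rewrite [RHS](@eq_graft _ (graft (tilde_lab p) (tilde_lab r) j.+1 l.+1) _
  (tilde_lab q) (n + l) m) //;
  [| by lia | by lia | by move=> *; apply: tilde_lab_comp].
have -> : (j'.+1 = j.+1 + m.+1 - 1)%N by lia.
by rewrite iE; apply: graft_par; lia.
Qed.

Definition multitilde_set_operad : set_operad :=
  @SetOperad multitilde multitilde_one multitilde_comp
    multitilde_comp1x multitilde_compx1 multitilde_seq multitilde_par.

Definition MT (K : fieldType) : operad K := linearization K multitilde_set_operad.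

(* The multi-tilde (1, {(1, 1)}). *)
Definition tilde11 : multitilde 0 := [set a | coords a == (1, 1)%N].

Definition proper_tilde n (s : multitilde n) : bool :=
  Tagged multitilde s != Tagged multitilde tilde11.

Definition proper_multitilde (n : nat) := {s : multitilde n | proper_tilde s}.

Definition proper_span (K : fieldType) (n : nat) : {pred MT K n} :=
  fun v => v \in <<[seq basis K (val s) | s : proper_multitilde n]>>%VS.
Arguments proper_span K n : clear implicits.

Definition phi_lab n (s : multitilde n) : {ffun arc n -> D0} :=
  [ffun a : arc n => tilde_lab s (val a).1 (val a).2].

Lemma phi_subproof n (s : proper_multitilde n) :
  (n == 0)%N ==> [forall a, phi_lab (val s) a == D0_one].
Proof.
apply/implyP => /eqP n0; move: s; rewrite n0 => -[s /= /negP s11].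
apply/forallP => a; rewrite ffunE /tilde_lab; case: ifP => //.
case/exists_inP => b bs _; case: s11; apply/eqP; congr (Tagged _ _).
have all11 (c : tilde 0) : coords c = (1, 1)%N.
  have /andP[h1 h2] := valP c; have h3 := ltn_ord (val c).2.
  by rewrite /coords; congr pair; lia.
apply/setP => c; rewrite inE all11 eqxx -(has_tilde_coords s c) all11.
by have := has_tilde_coords s b; rewrite all11 bs.
Qed.

Definition phi_clique n (s : proper_multitilde n) : clique n :=
  exist _ (phi_lab (val s)) (phi_subproof s).

(* The linear map on the span of the proper multi-tildes that sends each of *)
(* them to its clique, see phi_basis. *)
Definition phi (K : fieldType) (subMT : is_suboperad (proper_span K)) (n : nat)
    (v : suboperad subMT n) : CD0 K n :=
  \sum_(s : proper_multitilde n)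
    (val v : free_space K (multitilde n)) (val s) *: basis K (phi_clique s).

Arguments phi {K} subMT n v.

Lemma phi_linear K (subMT : is_suboperad (proper_span K)) n :
  linear (phi subMT n).
Proof.
move=> a u v; rewrite /phi scaler_sumr -big_split; apply: eq_bigr => s _ /=.
by rewrite !ffunE scalerDl scalerA.
Qed.

Lemma phi_basis K (subMT : is_suboperad (proper_span K)) n
    (v : suboperad subMT n) (s : proper_multitilde n) :
  val v = basis K (val s) -> phi subMT n v = basis K (phi_clique s).
Proof.
rewrite /phi => ->; rewrite (bigD1 s) //= ffunE eqxx scale1r big1 ?addr0 // => t ts.
by rewrite ffunE (inj_eq val_inj) (negPf ts) scale0r.
Qed.

(* Main.v *)
Require Import Defs.
From mathcomp Require Import all_boot all_order all_algebra.
From mathcomp Require Import zify.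

Set Implicit Arguments.
Unset Strict Implicit.
Unset Printing Implicit Defensive.

Import GRing.Theory.
Local Open Scope ring_scope.

(** A multi-tilde of arity [n] is a set of pairs [(x, y)] with
    [1 <= x <= y <= n], and [(x, y) |-> (x, y + 1)] identifies these pairs with
    the arcs of a clique of arity [n].  Labelling by [0] the arcs that come from
    the set and by the unit the others is therefore a bijection from multi-tildes
    to labellings of the arcs by [D0].  In arity 1, the convention on cliques
    keeps only the labelling that comes from the empty set, which is why
    [(1, {(1, 1)})] has to be removed; [phi_clique] is the resulting bijection
    from proper multi-tildes to cliques, and its inverse [phi_clique_inv]
    collects the arcs labelled [0].

    This bijection respects composition ([phi_clique_comp]): the shifts move the
    pairs of both multi-tildes exactly as grafting moves arcs.  The two
    families can overlap only on the arc along which the grafting is made; there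
    a union of sets on one side meets the product of two labels on the other,
    and in [D0] a product is [0] exactly when one of its factors is.  The
    arcs of the composite that come from neither clique are labelled by the
    unit, and no pair of either multi-tilde is shifted onto them.

    The rest is linear algebra.  Proper multi-tildes contain the unit and are
    stable under composition, because arities add up and the only proper
    multi-tilde of arity 1 is the unit; so their span is a suboperad
    ([proper_span_suboperad]).  As [phi] carries the basis of this span
    bijectively onto the basis of cliques, it is bijective ([phi_bijective]),
    and its compatibility with composition ([phi_comp]) follows from the case of
    basis elements by bilinearity. *)

(** * Proper multi-tildes *)

Lemma coords_arity1 (c : tilde 0) : coords c = (1, 1)%N.
Proof.
have /andP[h1 h2] := valP c; have h3 := ltn_ord (val c).2.
by rewrite /coords; congr pair; lia.
Qed.

Lemma tilde_arity1_eq (c d : tilde 0) : c = d.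
Proof.
have := has_tilde_coords [set d] d; have := has_tilde_coords [set d] c.
by rewrite !coords_arity1 set11 => -> /set1P.
Qed.

(** As [(1, 1)] is the only possible pair in arity 1, the empty multi-tilde is
    the only one there that differs from [(1, {(1, 1)})].  This replaces an
    inequality in the total space by a condition that can be computed with, and
    that mirrors the convention on cliques of arity 1. *)
Lemma proper_tildeE n (s : multitilde n) :
  proper_tilde s = (n == 0)%N ==> (s == set0).
Proof.
rewrite /proper_tilde -tag_eqE /tag_eq /=; case: n s => [|n] s //=.
rewrite tagged_asE; have [-> | [d ds]] := set_0Vmem s; last first.
  have -> : s = tilde11.
    by apply/setP => e; rewrite inE coords_arity1 eqxx (tilde_arity1_eq e d).
  rewrite eqxx; have [c cE] := @tildeE 0 1 1 isT isT.
  by apply/esym/negbTE/set0Pn; exists c; rewrite inE cE.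
rewrite eqxx eq_sym; have [c cE] := @tildeE 0 1 1 isT isT.
by apply/set0Pn; exists c; rewrite inE cE.
Qed.

Lemma proper_tilde_one : proper_tilde multitilde_one.
Proof. by rewrite proper_tildeE /= eqxx. Qed.

(** Only a composition of two elements of arity 1 has arity 1, and then both
    are the unit. *)
Lemma proper_tilde_comp n m (s : multitilde n) (i : 'I_n.+1) (t : multitilde m) :
  proper_tilde s -> proper_tilde t -> proper_tilde (multitilde_comp s i t).
Proof.
rewrite !proper_tildeE => ps pt; apply/implyP; rewrite addn_eq0 => /andP[n0 m0].
move: ps pt; rewrite n0 m0 /= => /eqP-> /eqP->; apply/eqP/setP => c.
rewrite !inE; apply/negbTE/norP.
by split; apply/negP => /imageP[a]; rewrite inE.
Qed.

(** * The bijection between proper multi-tildes and cliques *)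

Lemma lab_phi n (s : proper_multitilde n) x y : (0 < x < y)%N -> (y <= n.+2)%N ->
  lab (phi_clique s) x y = tilde_lab (val s) x y.
Proof.
move=> xy yn; have x_ok : (x < n.+3)%N by lia.
have y_ok : (y < n.+3)%N by lia.
pose a : Defs.arc n := exist _ (Ordinal x_ok, Ordinal y_ok) xy.
by rewrite (labE (phi_clique s) a : lab _ x y = _) ffunE.
Qed.

Definition zero_tildes n (q : clique n) : multitilde n :=
  [set a | lab q (coords a).1 (coords a).2.+1 == D0_zero].

Lemma zero_tildes_proper n (q : clique n) : proper_tilde (zero_tildes q).
Proof.
rewrite proper_tildeE; apply/implyP => /eqP n0; move: q; rewrite n0 => q.
by apply/eqP/setP => a; rewrite !inE lab_arity1.
Qed.

Definition phi_clique_inv n (q : clique n) : proper_multitilde n :=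
  exist _ (zero_tildes q) (zero_tildes_proper q).

Lemma tilde_lab_zero_tildes n (q : clique n) x y :
  (0 < x < y)%N -> (y <= n.+2)%N -> tilde_lab (zero_tildes q) x y = lab q x y.
Proof.
case: y => [|y]; first by rewrite ltn0 andbF.
move=> xy yn; rewrite /tilde_lab subn1 /=.
have [a aE] : exists a : tilde n, coords a = (x, y) by apply: tildeE; lia.
have := has_tilde_coords (zero_tildes q) a; rewrite inE aE /= => ->.
by case: (lab q x y.+1).
Qed.

Lemma phi_cliqueK n : cancel (@phi_clique n) (@phi_clique_inv n).
Proof.
move=> s; apply/val_inj/(@Tagged_inj multitilde_set_operad).
apply: multitilde_ext => // x y xy yn.
by rewrite tilde_lab_zero_tildes // lab_phi.
Qed.

Lemma phi_clique_invK n : cancel (@phi_clique_inv n) (@phi_clique n).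
Proof.
move=> q; apply: (@Tagged_inj clique_set_operad).
apply: clique_ext => // x y xy yn.
by rewrite lab_phi // tilde_lab_zero_tildes.
Qed.

(** The composite [s o_i t] enters as [u] together with an equation, so that the
    lemma does not depend on how its properness is proved. *)
Lemma phi_clique_comp n m (s : proper_multitilde n) (i : 'I_n.+1)
    (t : proper_multitilde m) (u : proper_multitilde (n + m)) :
  val u = multitilde_comp (val s) i (val t) ->
  phi_clique u = clique_comp (phi_clique s) i (phi_clique t).
Proof.
move=> uE; apply: (@Tagged_inj clique_set_operad).
apply: clique_ext => // x y xy yn.
rewrite lab_phi // uE tilde_lab_comp // lab_comp //.
have li := ltn_ord i.
apply: (@eq_graft _ _ _ _ n m); [lia | exact: xy | exact: yn | |];
  by move=> a b ab bn; rewrite lab_phi.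
Qed.

(** * The span of the proper multi-tildes *)

Section ProperSpan.

Variable K : fieldType.

Lemma basis_proper_span n (s : multitilde n) :
  proper_tilde s -> basis K s \in proper_span K n.
Proof.
by move=> ps; apply/memv_span/imageP; exists (exist _ s ps : proper_multitilde n).
Qed.

Lemma proper_span_submod n : submod_closed (@proper_span K n).
Proof. by split=> [|a u v uS vS]; [exact: mem0v | exact/memvD/vS/memvZ/uS]. Qed.

(** Every vector of the span vanishes on [(1, {(1, 1)})], so only the proper terms
    survive in its expansion over all multi-tildes. *)
Lemma proper_span_decomp n (v : free_space K (multitilde n)) :
  v \in proper_span K n ->
  v = \sum_(s : proper_multitilde n) v (val s) *: basis K (val s).
Proof.
move=> vS; have v0 s : ~~ proper_tilde s -> v s = 0.
  move=> ns; rewrite (coord_span (X := in_tuple _) vS) sum_ffunE big1 // => j _.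
  have /imageP[t _ tE] := mem_nth 0 (ltn_ord j).
  rewrite [in_tuple _]/= tE !ffunE (_ : s == val t = false) ?scaler0 //.
  by apply: contraNF ns => /eqP ->; exact: (valP t).
rewrite [LHS]free_decomp (bigID (@proper_tilde n)) /= [X in _ + X]big1 ?addr0.
  (* from the multi-tildes that are proper to the subtype that they form *)
  rewrite (reindex_omap (val : proper_multitilde n -> _) insub) => [|s ps];
    last by rewrite insubT.
  by apply: eq_bigl => s; rewrite valK eqxx (valP s).
by move=> s /v0 ->; rewrite scale0r.
Qed.

Lemma lin_comp_proper n m (v : MT K n) (i : 'I_n.+1) (w : MT K m) :
  v \in proper_span K n -> w \in proper_span K m ->
  op_comp (MT K) v i w
    = \sum_(st : proper_multitilde n * proper_multitilde m)
        (v (val st.1) * w (val st.2)) *: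
          basis K (multitilde_comp (val st.1) i (val st.2)).
Proof.
move=> vS wS; rewrite {1}(proper_span_decomp vS) {1}(proper_span_decomp wS).
exact: (@lin_comp_sum K multitilde_set_operad).
Qed.

Lemma proper_span_suboperad : is_suboperad (proper_span K).
Proof.
split=> [n||n m v i w vS wS]; first exact: proper_span_submod.
  exact/basis_proper_span/proper_tilde_one.
rewrite lin_comp_proper //; apply: memv_suml => st _; apply: memvZ.
exact/basis_proper_span/proper_tilde_comp/(valP st.2)/(valP st.1).
Qed.

End ProperSpan.

(** * The isomorphism *)

Section Phi.

Variables (K : fieldType) (subMT : is_suboperad (proper_span K)).

(** Coordinates are transported along the bijection of the bases; an identity in
    [CD0] can thus be checked coordinate by coordinate on proper
    multi-tildes. *)
Lemma phi_apply n (v : suboperad subMT n) (s : proper_multitilde n) :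
  (phi subMT n v : free_space K (clique n)) (phi_clique s)
    = (val v : free_space K (multitilde n)) (val s).
Proof.
rewrite sum_ffunE (bigD1 s) //= !ffunE eqxx big1 => [|t ts].
  by rewrite addr0 [LHS]mulr1.
rewrite !ffunE (inj_eq (can_inj (@phi_cliqueK n))) eq_sym (negPf ts).
exact: mulr0.
Qed.

Lemma phi_bijective n : bijective (phi subMT n).
Proof.
pose psi (f : free_space K (clique n)) : free_space K (multitilde n) :=
  \sum_(s : proper_multitilde n) f (phi_clique s) *: basis K (val s).
have psiS f : psi f \in proper_span K n.
  by apply: memv_suml => s _; apply/memvZ/basis_proper_span/(valP s).
exists (fun f => Sub (psi f) (psiS f) : suboperad subMT n) => [v|f].
  apply: val_inj; rewrite /= [RHS](proper_span_decomp (valP v)).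
  by apply: eq_bigr => s _; rewrite phi_apply.
apply/ffunP => q; rewrite -(phi_clique_invK q) phi_apply /=.
rewrite sum_ffunE (bigD1 (phi_clique_inv q)) //= !ffunE eqxx big1 => [|t ts].
  by rewrite addr0 [LHS]mulr1.
rewrite !ffunE (_ : zero_tildes q == val t = false) ?[LHS]mulr0 //.
by apply: contraNF ts => /eqP qt; apply/eqP/val_inj.
Qed.

(** Both sides expand over pairs of proper multi-tildes with the same
    coefficients, which leaves the composition of two basis elements. *)
Lemma phi_comp n m (v : suboperad subMT n) (i : 'I_n.+1) (w : suboperad subMT m) :
  phi subMT (n + m) (op_comp (suboperad subMT) v i w)
    = op_comp (CD0 K) (phi subMT n v) i (phi subMT m w).
Proof.
apply: etrans (esym (@lin_comp_sum K clique_set_operad _ _ _ _ _ _ _ _ _)).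
apply/ffunP => q; rewrite -(phi_clique_invK q) phi_apply.
rewrite [val _](lin_comp_proper _ (valP v) (valP w)).
rewrite !sum_ffunE; apply: eq_bigr => st _; rewrite !ffunE; congr (_ *: _%:R).
pose u : proper_multitilde (n + m) :=
  exist _ (multitilde_comp _ i _) (proper_tilde_comp i (valP st.1) (valP st.2)).
rewrite [so_comp _ _ _ _]/= -(@phi_clique_comp _ _ _ _ _ u) //.
by rewrite (inj_eq (can_inj (@phi_cliqueK _))).
Qed.

Lemma phi_isomorphism : operad_isomorphism (phi subMT).
Proof.
split; last exact: phi_bijective.
split; [exact: phi_linear | | exact: phi_comp].
pose one : proper_multitilde 0 := exist _ multitilde_one proper_tilde_one.
rewrite (@phi_basis _ _ _ _ one) //.
congr (basis K _); apply: val_inj; apply/ffunP => a; rewrite !ffunE.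
exact: tilde_lab_one.
Qed.

End Phi.

(** The inverses [g n] have to be selected uniformly in [n], whereas bijectivity
    is known for each [n] separately; the choice operator of the spaces does it. *)
Lemma isomorphic_operads_sym (K : fieldType) (O P : operad K)
    (f : forall n, O n -> P n) :
  operad_isomorphism f -> isomorphic_operads P O.
Proof.
case=> [[flin fone fcomp] fbij].
have fsurj n (y : P n) : exists x, f n x == y.
  by case: (fbij n) => g _ fK; exists (g y); rewrite fK.
pose g n (y : P n) : O n := xchoose (fsurj n y).
have fK n : cancel (g n) (f n) by move=> y; exact: eqP (xchooseP (fsurj n y)).
have finj n : injective (f n) := bij_inj (fbij n).
have gK n : cancel (f n) (g n) by move=> x; apply: finj; rewrite fK.
exists g; split=> [|n]; last by exists (f n).
split=> [n a y z||n m y i z]; apply: finj.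
- by rewrite flin !fK.
- by rewrite fK fone.
- by rewrite fcomp !fK.
Qed.

Theorem proposition5p3p1 (K : fieldType) (charK : [pchar K] =i pred0) :
  exists subMT : is_suboperad (proper_span K),
    isomorphic_operads (CD0 K) (suboperad subMT)
    /\ operad_isomorphism (phi subMT).
Proof.
exists (proper_span_suboperad K).
by split; [apply: isomorphic_operads_sym|]; exact: phi_isomorphism.
Qed.
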